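(* Let $k,b\in\mathbb{N}$ with $k,b\ge 1$, let $N=kb$, let $\sigma>0$, and let $\mathbf{C}\in\mathbb{R}^{N\times N}$ be a lower-triangular matrix with non-negative entries. For $1\le i\le b$ let $\mathbf{m}_i=\sum_{j=0}^{k-1}|\mathbf{C}|_{:,\,i+jb}\in\mathbb{R}^N$ and let $\mathbf{G}\in\mathbb{R}^{b\times b}$ be the Gram matrix $\mathbf{G}_{i,j}=\langle \mathbf{m}_i,\mathbf{m}_j\rangle$. Let $\hat P=\frac1b\sum_{i=1}^b\mathcal{N}(\mathbf{m}_i,\sigma^2 I_N)$ and $\hat Q=\mathcal{N}(0,\sigma^2 I_N)$. Then for every $\alpha>1$, $$R_\alpha(\hat Q\,\|\,\hat P)\le\frac{1}{2b\sigma^2}\sum_{j=1}^b\mathbf{G}_{j,j}+\frac{\alpha-1}{2b^2\sigma^2}\sum_{i=1}^b\sum_{j=1}^b\mathbf{G}_{i,j}.$$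
   Context: For probability distributions $P,Q$ with $P\ll Q$ and $\alpha>1$, the Rényi divergence is $R_\alpha(P\|Q)=\frac{1}{\alpha-1}\log\mathbb{E}_{x\sim P}\big[\big(\tfrac{dP}{dQ}(x)\big)^{\alpha-1}\big]$. $|\mathbf{C}|$ is the entrywise absolute value and $|\mathbf{C}|_{:,t}$ its $t$-th column (columns indexed from 1). *)

(* Defs.v *)
From HB Require Import structures.
From mathcomp Require Import all_boot all_order all_algebra.
From mathcomp Require Import all_classical all_reals all_analysis.

Set Implicit Arguments.
Unset Strict Implicit.
Unset Printing Implicit Defensive.

Import Order.TTheory GRing.Theory Num.Theory.
Import numFieldNormedType.Exports.

Local Open Scope classical_set_scope.
Local Open Scope charge_scope.
Local Open Scope ring_scope.

Section tuple_cons.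
Context d (T : measurableType d) (n : nat).

Definition tuple_cons (x : T * n.-tuple T) : n.+1.-tuple T :=
  [tuple of x.1 :: x.2].

Lemma measurable_tuple_cons : measurable_fun [set: T * n.-tuple T] tuple_cons.
Proof. by apply: measurable_cons. Qed.

HB.instance Definition _ :=
  isMeasurableFun.Build _ _ _ _ tuple_cons measurable_tuple_cons.

End tuple_cons.

(* P_0 \x ... \x P_{n-1} on T^n, with T^n represented by n.-tuple T, whose
   sigma-algebra is the product one; see tuple_probE. *)
Fixpoint tuple_prob d (T : measurableType d) (R : realType) (n : nat) :
    ('I_n -> probability T R) -> probability (n.-tuple T) R :=
  match n with
  | 0 => fun=> (\d_([tuple] : 0.-tuple T) : probability _ R)
  | n'.+1 => fun P =>
      (distribution (P ord0 \x tuple_prob (fun i => P (lift ord0 i)))%E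
         (@tuple_cons d T n') : probability _ R)
  end.

Lemma tuple_probE d (T : measurableType d) (R : realType) (n : nat)
    (P : 'I_n -> probability T R) (A : 'I_n -> set T) :
  (forall i, measurable (A i)) ->
  tuple_prob P [set x | forall i, A i (tnth x i)] = (\prod_(i < n) P i (A i))%E.
Proof.
elim: n P A => [|n IHn] P A mA.
  by rewrite big_ord0 /= diracE mem_set//= => -[].
rewrite big_ord_recl -IHn => [|i]; last exact: mA.
rewrite /= /distribution /pushforward.
rewrite -product_measure1E//; last first.
  rewrite [X in measurable X](_ : _ = \bigcap_i
      ((@tnth n T ^~ i) @^-1` A (lift ord0 i))); last first.
    by apply/seteqP; split => x Ax i => [_|]; exact: Ax.
  apply: fin_bigcap_measurable => // i _.
  by rewrite -[X in measurable X]setTI; exact: measurable_tnth.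
congr (_ _); apply/seteqP; split => -[x y] /=.
- move=> Axy; split => [|i]; first exact: (Axy ord0).
  by have := Axy (lift ord0 i); rewrite tnthS.
- move=> [Ax Ay] i; case: (unliftP ord0 i) => [j|] ->//.
  by rewrite tnthS.
Qed.

(* N(m, sigma^2 I_N): independent coordinates, the i-th one being
   N(m_i, sigma^2). *)
Definition gauss_iso (R : realType) (N : nat) (m : 'cV[R]_N) (sigma : R) :
    probability (N.-tuple (measurableTypeR R)) R :=
  tuple_prob (fun i => (normal_prob (m i 0) sigma : probability _ R)).

Section unif_mixture.
Context d (T : measurableType d) (R : realType) (b : nat).
Variables (b_gt0 : (0 < b)%N) (P : 'I_b -> probability T R).
Local Open Scope ereal_scope.

Definition unif_mixture of (0 < b)%N := fun A : set T =>
  (b%:R^-1)%:E * \sum_(i < b) P i A.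

Local Notation mix := (unif_mixture b_gt0).

Let mix0 : mix set0 = 0.
Proof. by rewrite /unif_mixture big1 ?mule0. Qed.

Let mix_ge0 A : 0 <= mix A.
Proof. by rewrite /unif_mixture mule_ge0// ?lee_fin ?invr_ge0// sume_ge0. Qed.

Let mix_sigma_additive : semi_sigma_additive mix.
Proof.
move=> F mF tF mUF; rewrite /unif_mixture.
rewrite [X in X @ _ --> _](_ : _ = (fun n =>
    (b%:R^-1)%:E * \sum_(i < b) \sum_(0 <= k < n) P i (F k))); last first.
  apply/funext => n; rewrite exchange_big/= ge0_sume_distrr// => i _.
  by rewrite sume_ge0.
apply: cvgeZl => //; apply: cvg_nnesum => [i _|i _].
  by apply: nearW => n; rewrite sume_ge0.
exact: measure_semi_sigma_additive.
Qed.

HB.instance Definition _ := isMeasure.Build _ _ _ mix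
  mix0 mix_ge0 mix_sigma_additive.

Let mix_setT : mix setT = 1.
Proof.
rewrite /unif_mixture (eq_bigr (fun=> 1)) => [|i _]; last exact: probability_setT.
rewrite sumEFin -EFinM sumr_const card_ord mulVf// pnatr_eq0.
by rewrite -lt0n.
Qed.

HB.instance Definition _ := Measure_isProbability.Build _ _ _ mix mix_setT.

End unif_mixture.

(* The value +oo when P is not absolutely continuous with respect to Q is the
   usual convention. *)
Definition renyi_div d (T : measurableType d) (R : realType) (alpha : R)
    (P Q : probability T R) : \bar R :=
  if pselect (P `<< Q) then
    (((alpha - 1)^-1)%:E *
     lne (\int[P]_x (('d (charge_of_finite_measure P) '/d Q) x
                      `^ (alpha - 1))))%E
  else +oo%E.

(* The 0-based column index i + j * b. *)
Lemma batch_col_subproof (k b : nat) (i : 'I_b) (j : 'I_k) :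
  (i + j * b < k * b)%N.
Proof.
apply: (@leq_trans (j.+1 * b)); first by rewrite mulSn ltn_add2r.
by rewrite leq_mul2r ltn_ord orbT.
Qed.

Definition batch_col (k b : nat) (i : 'I_b) (j : 'I_k) : 'I_(k * b) :=
  Ordinal (batch_col_subproof i j).

Definition batch_mean (R : realType) (k b : nat) (C : 'M[R]_(k * b))
    (i : 'I_b) : 'cV[R]_(k * b) :=
  \sum_(j < k) col (batch_col i j) (map_mx Num.norm C).

Definition gram (R : realType) (N b : nat) (m : 'I_b -> 'cV[R]_N) : 'M[R]_b :=
  \matrix_(i, j) \sum_(t < N) m i t 0 * m j t 0.

(* Main.v *)
(* Let p be the density of the mixture with respect to N(0, s^2 I). It is
   positive, so dQ/dP = 1/p, and by AM-GM it is at least the geometric mean of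
   the densities of the components, which is the exponential of an affine
   function of x. Hence E_Q[p^(1 - alpha)] is at most a Gaussian moment
   generating function, whose value is exactly the exponential of (alpha - 1)
   times the claimed bound. *)

Require Import Defs.
From mathcomp Require Import all_boot all_order all_algebra.
From mathcomp Require Import all_classical all_reals all_analysis.
From mathcomp Require Import measurable_realfun ring.

Set Implicit Arguments.
Unset Strict Implicit.
Unset Printing Implicit Defensive.

Import Order.TTheory GRing.Theory Num.Theory.
Import numFieldNormedType.Exports.

Local Open Scope classical_set_scope.
Local Open Scope charge_scope.
Local Open Scope ring_scope.

(** The inverse of a positive number is its real power of exponent [-1], and real powers are
    measurable. *)
Lemma measurable_fun_inv d (T : measurableType d) (R : realType) (f : T -> R) :
  measurable_fun setT f -> (forall x, 0 < f x) ->
  measurable_fun setT (fun x => (f x)^-1).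
Proof.
move=> mf f_gt0; have -> : (fun x => (f x)^-1) = (fun x => f x `^ (-1)).
  by apply/funext => x; rewrite powR_inv1// ltW.
exact: (measurableT_comp (measurable_powR (-1)) mf).
Qed.

(** * Densities of one measure with respect to another *)

Section density.
Local Open Scope ereal_scope.
Context d (T : measurableType d) (R : realType).

(** Phrased with integrals of non-negative functions, so that inverting a density or iterating over
    coordinates is a mere choice of [f]. [P] and [Q] are bare set functions, which lets Lebesgue
    measure serve as a reference. *)
Definition has_density (P Q : set T -> \bar R) (g : T -> R) :=
  forall f : T -> \bar R, measurable_fun setT f -> (forall x, 0 <= f x) ->
    \int[P]_x f x = \int[Q]_x (f x * (g x)%:E).

(** Both [g] and the Radon-Nikodym derivative of [nu] integrate to [nu A] over every measurable [A],
    so they agree [mu]-almost everywhere; the change of variables for the derivative then carries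
    over to [g]. *)
Lemma has_density_set (nu : {finite_measure set T -> \bar R})
    (mu : {sigma_finite_measure set T -> \bar R}) (g : T -> R) :
  measurable_fun setT g -> (forall x, (0 <= g x)%R) ->
  (forall A, measurable A -> nu A = \int[mu]_(x in A) (g x)%:E) ->
  has_density nu mu g.
Proof.
move=> mg g0 nuE f mf f0.
have numu : nu `<< mu.
  apply/null_content_dominatesP => A mA muA0; rewrite nuE//.
  by apply: null_set_integral => //; exact/measurable_EFinP/measurable_funTS.
rewrite -(Radon_Nikodym_SigmaFinite.change_of_variables numu f0)//.
have mh := measurable_int _ (Radon_Nikodym_SigmaFinite.f_integrable numu).
apply: ge0_ae_eq_integral => //.
- exact: emeasurable_funM.
- by apply: emeasurable_funM => //; exact/measurable_EFinP.
- by move=> x _; rewrite mule_ge0// Radon_Nikodym_SigmaFinite.f_ge0.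
- by move=> x _; rewrite mule_ge0// lee_fin.
apply: ae_eqe_mul2l; apply: integral_ae_eq => //.
- exact: Radon_Nikodym_SigmaFinite.f_integrable.
- exact/measurable_EFinP.
- by move=> A _ mA; rewrite -nuE// -(Radon_Nikodym_SigmaFinite.f_integral numu).
Qed.

Variables (P Q : probability T R) (g : T -> R).
Hypotheses (mg : measurable_fun setT g) (g_gt0 : forall x, (0 < g x)%R).
Hypothesis PQ : has_density P Q g.

(** Apply the hypothesis [PQ] to [f / g]: the positive factor [g] cancels. *)
Lemma has_density_inv : has_density Q P (fun x => (g x)^-1)%R.
Proof.
move=> f mf f0; rewrite PQ.
- by apply: eq_integral => x _; rewrite -muleA -EFinM mulVf ?mule1 ?gt_eqF.
- apply: emeasurable_funM => //; apply/measurable_EFinP.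
  exact: measurable_fun_inv.
- by move=> x; rewrite mule_ge0// lee_fin invr_ge0 ltW.
Qed.

End density.

Lemma has_density_setE d (T : measurableType d) (R : realType)
    (P Q : probability T R) (g : T -> R) A :
  (forall x, 0 <= g x) ->
  has_density P Q g -> measurable A -> P A = (\int[Q]_(x in A) (g x)%:E)%E.
Proof.
move=> g0 PQ mA; rewrite -[in LHS](setIT A) -integral_indic// PQ//; last first.
  by apply/measurable_EFinP/measurable_indic.
rewrite [RHS]integral_mkcond; apply: eq_integral => x _.
by rewrite patchE indicE; case: ifPn => _ /=; rewrite ?mul1e ?mul0e.
Qed.

Lemma has_density_dominates d (T : measurableType d) (R : realType)
    (P Q : probability T R) (g : T -> R) :
  measurable_fun setT g -> (forall x, 0 <= g x) -> has_density P Q g -> P `<< Q.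
Proof.
move=> mg g0 PQ; apply/null_content_dominatesP => A mA QA0.
rewrite (has_density_setE _ PQ)//; apply: null_set_integral => //.
exact/measurable_EFinP/measurable_funTS.
Qed.

(** Integrals over all measurable sets determine an integrable function almost everywhere. *)
Lemma has_density_Radon_Nikodym d (T : measurableType d) (R : realType)
    (P Q : probability T R) (g : T -> R) :
  measurable_fun setT g -> (forall x, 0 <= g x) -> has_density P Q g ->
  ae_eq Q setT ('d (charge_of_finite_measure P) '/d Q) (EFin \o g).
Proof.
move=> mg g0 PQ; have dom := has_density_dominates mg g0 PQ.
apply: integral_ae_eq => //.
- exact: Radon_Nikodym_integrable.
- exact/measurable_EFinP.
- move=> A _ mA; rewrite -Radon_Nikodym_integral//.
  by rewrite -(has_density_setE g0 PQ).
Qed.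

(** * Densities of Gaussians, product measures and mixtures *)

Lemma has_density_normal (R : realType) (m s : R) : s != 0 ->
  has_density (normal_prob m s) (normal_prob 0 s)
    (fun x => expR (m * x / s ^+ 2 - m ^+ 2 / (2 * s ^+ 2))).
Proof.
move=> s0 f mf f0.
(* Pass through Lebesgue measure: the claimed density is the quotient of two normal densities, in
   which the terms quadratic in [x] cancel. *)
have dens (m' : R) : has_density (normal_prob m' s) lebesgue_measure
    (normal_pdf m' s).
  apply: has_density_set => //; first exact: measurable_normal_pdf.
  exact: normal_pdf_ge0.
have mexp : measurable_fun setT
    (fun x : R => expR (m * x / s ^+ 2 - m ^+ 2 / (2 * s ^+ 2))).
  apply: measurableT_comp => //; apply: measurable_funB => //.
  by apply: measurable_funM => //; apply: measurable_funM.
rewrite (dens m)// (dens 0 (fun x => f x * (expR _)%:E)%E); first last.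
- by move=> x; rewrite mule_ge0// lee_fin expR_ge0.
- by apply: emeasurable_funM => //; exact/measurable_EFinP.
apply: eq_integral => x _; rewrite -muleA -EFinM; congr (_ * _%:E)%E.
rewrite !normal_pdfE// /normal_fun mulrCA -expRD; congr (_ * expR _).
by field.
Qed.


Section tuple_density.
Local Open Scope ereal_scope.
Context d (T : measurableType d) (R : realType).

(** Induction on [n]: [tuple_cons] splits off the first coordinate, Tonelli makes both integrals
    iterated, and the densities of the first factor and of the remaining ones are applied in
    turn. *)
Lemma has_density_tuple n (P Q : 'I_n -> probability T R) (g : 'I_n -> T -> R) :
  (forall i, measurable_fun setT (g i)) -> (forall i x, (0 <= g i x)%R) ->
  (forall i, has_density (P i) (Q i) (g i)) ->
  has_density (tuple_prob P) (tuple_prob Q)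
    (fun x => \prod_(i < n) g i (tnth x i))%R.
Proof.
elim: n P Q g => [|n IHn] P Q g mg g0 PQ f mf f0.
  (* Without coordinates both measures are the Dirac mass at the empty tuple. *)
  apply: eq_integral => x _.
  by rewrite big_ord0 mule1.
have mgP k (h : 'I_k -> T -> R) : (forall i, measurable_fun setT (h i)) ->
    measurable_fun setT (fun x : k.-tuple T => \prod_(i < k) h i (tnth x i))%R.
  move=> mh; apply: measurable_prod => i _.
  by apply: (measurableT_comp (mh i)); exact: measurable_tnth.
have mfg : measurable_fun setT
    (fun x : n.+1.-tuple T => f x * (\prod_(i < n.+1) g i (tnth x i))%:E).
  by apply: emeasurable_funM => //; apply/measurable_EFinP; exact: mgP.
have fg0 (x : n.+1.-tuple T) : 0 <= f x * (\prod_(i < n.+1) g i (tnth x i))%:E.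
  rewrite mule_ge0// lee_fin; apply: prodr_ge0 => i _; exact: g0.
have mcons := @measurable_tuple_cons _ T n.
rewrite /= !ge0_integral_distribution//.
rewrite fubini_tonelli1//=; last exact: (measurableT_comp mf mcons).
rewrite fubini_tonelli1//=; last exact: (measurableT_comp mfg mcons).
have mF (S : probability (n.-tuple T) R) (h : n.+1.-tuple T -> \bar R) :
    measurable_fun setT h -> (forall x, 0 <= h x) ->
    measurable_fun setT (fubini_F S (h \o @tuple_cons _ T n)).
  move=> mh h0; apply: measurable_fun_fubini_tonelli_F => [|x /=//].
  exact: (measurableT_comp mh mcons).
rewrite PQ//; last 2 first.
- exact: (mF _ f).
- by move=> x; apply: integral_ge0 => y _ /=; exact: f0.
apply: eq_integral => x _.
have mx (h : n.+1.-tuple T -> \bar R) : measurable_fun setT h ->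
    measurable_fun setT (fun y : n.-tuple T => h (tuple_cons (x, y))).
  move=> mh; apply: (measurableT_comp mh).
  by apply: (measurableT_comp mcons); exact: measurable_pair1.
rewrite /fubini_F /= (IHn _ (fun i => Q (lift ord0 i))
  (fun i => g (lift ord0 i)))//; last exact: mx.
(* [g ord0 x] is constant in the inner variable, so it moves under the inner integral. *)
rewrite -ge0_integralZr//; last 3 first.
- apply: emeasurable_funM; first exact: mx.
  apply/measurable_EFinP; exact: (mgP _ (fun i => g (lift ord0 i))).
- by move=> y _; rewrite mule_ge0// lee_fin; apply: prodr_ge0 => i _; exact: g0.
- by rewrite lee_fin.
apply: eq_integral => y _; rewrite -muleA -EFinM big_ord_recl mulrC.
by congr (_ * (_ * _)%:E); apply: eq_bigr => i _; rewrite tnthS.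
Qed.

End tuple_density.

(** By linearity the identity holds on measurable sets, and [has_density_set] extends it to
    functions. *)
Lemma has_density_unif_mixture d (T : measurableType d) (R : realType) (b : nat)
    (b_gt0 : (0 < b)%N) (P : 'I_b -> probability T R) (Q : probability T R)
    (g : 'I_b -> T -> R) :
  (forall i, measurable_fun setT (g i)) -> (forall i x, 0 <= g i x) ->
  (forall i, has_density (P i) Q (g i)) ->
  has_density (unif_mixture P b_gt0) Q
    (fun x => b%:R^-1 * \sum_(i < b) g i x).
Proof.
move=> mg g0 PQ.
have mEg i : measurable_fun setT (EFin \o g i) by exact/measurable_EFinP.
apply: has_density_set => [|x|A mA].
- by apply: measurable_funM => //; exact: measurable_sum.
- by rewrite mulr_ge0// ?invr_ge0// sumr_ge0.
rewrite /= /unif_mixture.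
under [RHS]eq_integral do rewrite EFinM -sumEFin.
rewrite ge0_integralZl//.
- rewrite ge0_integral_sum//.
  + congr (_ * _)%E; apply: eq_bigr => i _.
    exact: has_density_setE (PQ i) mA.
  + by move=> i; apply: measurable_funTS; exact: mEg.
  + by move=> i x _; rewrite lee_fin.
- by apply: emeasurable_sum => i; apply: measurable_funTS; exact: mEg.
- by move=> x _; rewrite sume_ge0// => i _; rewrite lee_fin.
Qed.

(** The product of the coordinate densities is written as a single exponential, so that a geometric
    mean of such densities averages the exponents. *)
Lemma has_density_gauss_iso (R : realType) N (m : 'cV[R]_N) (s : R) : s != 0 ->
  has_density (gauss_iso m s) (gauss_iso 0 s) (fun x => expR (\sum_(t < N)
    (m t 0 * tnth x t / s ^+ 2 - m t 0 ^+ 2 / (2 * s ^+ 2)))).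
Proof.
move=> s0.
pose g t x := expR (m t 0 * x / s ^+ 2 - m t 0 ^+ 2 / (2 * s ^+ 2)).
have -> : (fun x : N.-tuple R => expR (\sum_(t < N)
    (m t 0 * tnth x t / s ^+ 2 - m t 0 ^+ 2 / (2 * s ^+ 2)))) =
    (fun x => \prod_(t < N) g t (tnth x t)).
  by apply/funext => x; rewrite expR_sum.
apply: has_density_tuple => [t|t x|t].
- apply: measurableT_comp => //; apply: measurable_funB => //.
  by apply: measurable_funM => //; apply: measurable_funM.
- exact: expR_ge0.
- by rewrite mxE; exact: has_density_normal.
Qed.

(** * The Gaussian moment generating function *)

Lemma has_density_integral d (T : measurableType d) (R : realType)
    (P Q : probability T R) (g : T -> R) :
  has_density P Q g -> (\int[Q]_x (g x)%:E = 1)%E.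
Proof.
move=> PQ; transitivity (\int[P]_x cst 1%E x)%E.
  by rewrite PQ//; apply: eq_integral => x _; rewrite mul1e.
by rewrite integral_cst// mul1e; exact: probability_setT.
Qed.

Lemma measurable_tuple_linear (R : realType) N (c : 'I_N -> R) :
  measurable_fun [set: N.-tuple (measurableTypeR R)]
    (fun x => \sum_(t < N) c t * tnth x t).
Proof.
apply: measurable_sum => t; apply: measurable_funM => //.
exact: measurable_tnth.
Qed.

Lemma gauss_iso_mgf (R : realType) N (c : 'I_N -> R) (s : R) : s != 0 ->
  (\int[gauss_iso (0 : 'cV_N) s]_x
     (expR ((\sum_(t < N) c t * tnth x t) / s ^+ 2))%:E =
   (expR ((\sum_(t < N) c t ^+ 2) / (2 * s ^+ 2)))%:E)%E.
Proof.
move=> s0.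
pose m : 'cV[R]_N := \col_t c t.
have mlin : measurable_fun [set: N.-tuple (measurableTypeR R)]
    (fun x => (expR ((\sum_(t < N) c t * tnth x t) / s ^+ 2))%:E).
  apply/measurable_EFinP; apply: measurableT_comp => //.
  by apply: measurable_funM => //; exact: measurable_tuple_linear.
(* The density of N(m, s^2 I) with respect to N(0, s^2 I) has integral 1. *)
have := has_density_integral (has_density_gauss_iso m s0).
have densE x : (expR (\sum_(t < N)
      (m t 0 * tnth x t / s ^+ 2 - m t 0 ^+ 2 / (2 * s ^+ 2))))%:E =
    ((expR (- ((\sum_(t < N) c t ^+ 2) / (2 * s ^+ 2))))%:E *
     (expR ((\sum_(t < N) c t * tnth x t) / s ^+ 2))%:E)%E.
  rewrite -EFinM -expRD addrC; congr (expR _)%:E.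
  by rewrite sumrB !mulr_suml; congr (_ - _);
    apply: eq_bigr => t _; rewrite mxE.
under eq_integral do rewrite densE.
rewrite ge0_integralZl//.
move=> /(congr1 (mule (expR ((\sum_(t < N) c t ^+ 2) / (2 * s ^+ 2)))%:E)).
by rewrite mule1 muleA -EFinM -expRD subrr expR0 mul1e => <-.
Qed.

(** * Rényi divergence through a positive density *)

Lemma renyi_div_density d (T : measurableType d) (R : realType) (alpha : R)
    (P Q : probability T R) (p : T -> R) :
  measurable_fun setT p -> (forall x, 0 < p x) -> has_density P Q p ->
  renyi_div alpha Q P =
  (((alpha - 1)^-1)%:E * lne (\int[Q]_x (p x `^ (1 - alpha))%:E))%E.
Proof.
move=> mp p_gt0 PQ.
have mV := measurable_fun_inv mp p_gt0.
have V_ge0 x : 0 <= (p x)^-1 by rewrite invr_ge0 ltW.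
(* Inverting the density also gives absolute continuity of [Q] with respect to [P], which selects
   the integral branch of [renyi_div]. *)
have QP := has_density_inv mp p_gt0 PQ.
have dom := has_density_dominates mV V_ge0 QP.
rewrite /renyi_div; case: pselect => [_ /=|//].
congr (_ * lne _)%E.
have RN : ae_eq Q setT ('d (charge_of_finite_measure Q) '/d P)
    (EFin \o (fun x => (p x)^-1)).
  (* The derivative is identified only [P]-almost everywhere, while the integral is against [Q];
     absolute continuity transfers the identity. *)
  apply: null_dominates_ae_eq dom _ => //.
  exact: has_density_Radon_Nikodym.
apply: ae_eq_integral => //.
- apply: (measurableT_comp (measurable_poweR _)).
  by apply: measurable_int; exact: Radon_Nikodym_integrable.
- apply/measurable_EFinP; exact: (measurableT_comp (measurable_powR _) mp).
- apply: filterS RN => x /= /(_ I) -> _; rewrite poweR_EFin; congr EFin.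
  by rewrite -powR_inv1 ?ltW// -powRrM mulN1r opprB.
Qed.

Lemma expR_mean_le (R : realType) (b : nat) (u : 'I_b -> R) : (0 < b)%N ->
  expR (b%:R^-1 * \sum_(i < b) u i) <= b%:R^-1 * \sum_(i < b) expR (u i).
Proof.
move=> b0; set v := b%:R^-1 * _.
have bn0 : b%:R != 0 :> R by rewrite pnatr_eq0 -lt0n.
(* Sum the tangent line bounds of expR at the mean v: the linear terms
   cancel. *)
have -> : expR v = b%:R^-1 * \sum_(i < b) expR v * (1 + (u i - v)).
  rewrite -mulr_sumr big_split/= sumrB !sumr_const card_ord /v.
  by rewrite -mulr_natl; field.
rewrite ler_wpM2l ?invr_ge0// ler_sum// => i _.
rewrite -[in leRHS](subrK v (u i)) expRD [leRHS]mulrC ler_wpM2l ?expR_ge0//.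
exact: expR_ge1Dx.
Qed.

(** Both sides are the squared norm of the sum of the means; the right one is the form that the
    moment generating function produces. *)
Lemma gram_sum (R : realType) N b (m : 'I_b -> 'cV[R]_N) :
  \sum_(i < b) \sum_(j < b) gram m i j =
  \sum_(t < N) (\sum_(i < b) m i t 0) ^+ 2.
Proof.
under [RHS]eq_bigr do rewrite expr2 big_distrlr/=.
rewrite [RHS]exchange_big; apply: eq_bigr => i _.
by rewrite [RHS]exchange_big; apply: eq_bigr => j _; rewrite mxE.
Qed.

(** * The divergence bound for a uniform mixture of Gaussians *)

Lemma renyi_div_gauss_mixture (R : realType) N b (b_gt0 : (0 < b)%N)
    (m : 'I_b -> 'cV[R]_N) (s alpha : R) : 0 < s -> 1 < alpha ->
  (renyi_div alpha (gauss_iso 0 s)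
     (unif_mixture (fun i => gauss_iso (m i) s) b_gt0) <=
   (1 / (2 * b%:R * s ^+ 2) * \sum_(j < b) gram m j j +
    (alpha - 1) / (2 * b%:R ^+ 2 * s ^+ 2) *
      \sum_(i < b) \sum_(j < b) gram m i j)%:E)%E.
Proof.
move=> s_gt0 alpha_gt1; have s0 : s != 0 by rewrite gt_eqF.
have bn0 : b%:R != 0 :> R by rewrite pnatr_eq0 -lt0n.
have a_gt0 : 0 < alpha - 1 by rewrite subr_gt0.
pose u i (x : N.-tuple (measurableTypeR R)) :=
  \sum_(t < N) (m i t 0 * tnth x t / s ^+ 2 - m i t 0 ^+ 2 / (2 * s ^+ 2)).
pose g i x := expR (u i x).
pose p x := b%:R^-1 * \sum_(i < b) g i x.
have mg i : measurable_fun setT (g i).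
  apply: measurableT_comp => //; apply: measurable_sum => t.
  apply: measurable_funB => //; apply: measurable_funM => //.
  by apply: measurable_funM => //; exact: measurable_tnth.
have mp : measurable_fun setT p.
  by apply: measurable_funM => //; exact: measurable_sum.
(* The left side is the geometric mean of the component densities. *)
have p_ge x : expR (b%:R^-1 * \sum_(i < b) u i x) <= p x by exact: expR_mean_le.
have p_gt0 x : 0 < p x by apply: lt_le_trans (p_ge x); exact: expR_gt0.
have dens : has_density (unif_mixture (fun i => gauss_iso (m i) s) b_gt0)
    (gauss_iso 0 s) p.
  apply: has_density_unif_mixture => [i|i x|i]; first exact: mg.
  - exact: expR_ge0.
  - exact: has_density_gauss_iso.
rewrite (renyi_div_density _ mp p_gt0 dens) lee_pdivrMl//.
(* Up to the factor [s ^- 2], [c] holds the linear coefficients of [(1 - alpha)] times the averaged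
   exponent, and [K] is its constant term. *)
pose c t := - ((alpha - 1) / b%:R) * \sum_(i < b) m i t 0.
pose K := (alpha - 1) / (2 * b%:R * s ^+ 2) * \sum_(j < b) gram m j j.
have p_le x : p x `^ (1 - alpha) <=
    expR K * expR ((\sum_(t < N) c t * tnth x t) / s ^+ 2).
  have -> : expR K * expR ((\sum_(t < N) c t * tnth x t) / s ^+ 2) =
      expR (b%:R^-1 * \sum_(i < b) u i x) `^ (1 - alpha).
    rewrite -expRD -expRM; congr expR.
    have -> : \sum_(i < b) u i x =
        (\sum_(t < N) (\sum_(i < b) m i t 0) * tnth x t) / s ^+ 2 -
        (\sum_(j < b) gram m j j) / (2 * s ^+ 2).
      rewrite /u; under eq_bigr do rewrite sumrB -!mulr_suml.
      rewrite sumrB -!mulr_suml; congr (_ / _ - _ / _).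
        by rewrite exchange_big; apply: eq_bigr => t _; rewrite mulr_suml.
      by apply: eq_bigr => i _; rewrite mxE.
    have -> : \sum_(t < N) c t * tnth x t = - ((alpha - 1) / b%:R) *
        \sum_(t < N) (\sum_(i < b) m i t 0) * tnth x t.
      by rewrite mulr_sumr; apply: eq_bigr => t _; rewrite /c mulrA.
    by rewrite /K; field; rewrite s0 bn0.
  (* The exponent [1 - alpha] is negative, so taking powers reverses [p_ge]. *)
  rewrite -opprB !powRN lef_pV2 ?posrE ?powR_gt0 ?expR_gt0//.
  by apply: ge0_ler_powR; rewrite ?nnegrE ?expR_ge0// ltW.
have mlin : measurable_fun [set: N.-tuple (measurableTypeR R)]
    (fun x => (expR ((\sum_(t < N) c t * tnth x t) / s ^+ 2))%:E).
  apply/measurable_EFinP; apply: measurableT_comp => //.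
  by apply: measurable_funM => //; exact: measurable_tuple_linear.
set I := (\int[_]_x _)%E.
have I_ge0 : (0 <= I)%E by apply: integral_ge0 => x _; rewrite lee_fin powR_ge0.
(* The logarithm of [expR K] times the moment generating function at [c]. *)
pose E := K + (\sum_(t < N) c t ^+ 2) / (2 * s ^+ 2).
have I_le : (I <= (expR E)%:E)%E.
  rewrite expRD EFinM -(gauss_iso_mgf c s0) -ge0_integralZl//.
  apply: ge0_le_integral => //.
  - by move=> x _; rewrite lee_fin powR_ge0.
  - apply/measurable_EFinP; exact: (measurableT_comp (measurable_powR _) mp).
  - exact: measurable_funeM.
  - by move=> x _; rewrite -EFinM lee_fin.
(* No slack is left: [K] gives the diagonal term of the bound, and the squared norm of [c] gives the
   double sum through [gram_sum]. *)
have -> : ((alpha - 1)%:E * (1 / (2 * b%:R * s ^+ 2) * \sum_(j < b) gram m j j +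
    (alpha - 1) / (2 * b%:R ^+ 2 * s ^+ 2) *
      \sum_(i < b) \sum_(j < b) gram m i j)%:E = lne (expR E)%:E)%E.
  rewrite lne_EFin ?expR_gt0// expRK -EFinM gram_sum /E /K; congr EFin.
  have -> : \sum_(t < N) c t ^+ 2 = ((alpha - 1) / b%:R) ^+ 2 *
      \sum_(t < N) (\sum_(i < b) m i t 0) ^+ 2.
    by rewrite mulr_sumr; apply: eq_bigr => t _; rewrite /c exprMn sqrrN.
  by field; rewrite s0 bn0.
by rewrite lee_lne// in_itv/= ?I_ge0 ?leey// lee_fin expR_ge0.
Qed.

Theorem lemma3p4 (R : realType) (k b : nat) (hk : (1 <= k)%N) (hb : (1 <= b)%N)
    (sigma : R) (hsigma : 0 < sigma)
    (C : 'M[R]_(k * b)) (Clower : is_trig_mx C)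
    (Cge0 : forall i j, 0 <= C i j)
    (alpha : R) (halpha : 1 < alpha) :
  let m := batch_mean C in
  let G := gram m in
  let Phat := unif_mixture (fun i => gauss_iso (m i) sigma) hb in
  let Qhat := gauss_iso 0 sigma in
  (renyi_div alpha Qhat Phat <=
   (1 / (2 * b%:R * sigma ^+ 2) * \sum_(j < b) G j j +
    (alpha - 1) / (2 * b%:R ^+ 2 * sigma ^+ 2) *
      \sum_(i < b) \sum_(j < b) G i j)%:E)%E.
Proof. exact: renyi_div_gauss_mixture. Qed.
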